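(* Let $X_0$ be a finite connected graph. There is a natural isomorphism $\varphi$ of the Picard group ${\rm Pic}(X_0)$ onto the Jacobian $\mathcal{J}(X_0)$, namely the one given by $$\varphi\big(\partial\alpha \ \text{modulo}\ {\rm Prin}(X_0)\big)=P_0(\alpha)\ \text{modulo}\ H_1(X_0,\mathbb{Z})\qquad(\alpha\in C_1(X_0,\mathbb{Z})).$$
   Context: $X_0=(V_0,E_0)$ is a finite connected graph with vertex set $V_0$ and set $E_0$ of directed edges (each edge counted with both directions); $o(e)$, $t(e)$, $\overline{e}$ denote origin, terminus and inverse of $e$. Loops and multiple edges are allowed; every vertex is assumed to have degree at least three. $C_0(X_0,\mathbb{Z})$, $C_1(X_0,\mathbb{Z})$ (with $\overline{e}=-e$) and their real versions are the cellular chain groups, $\partial e=t(e)-o(e)$, $H_1(X_0,\mathbb{Z})=\ker\partial$. $C_0(X_0,\mathbb{R})$ has the inner product for which $V_0$ is an orthonormal basis, and $C_1(X_0,\mathbb{R})$ the one with $\langle e,e'\rangle=1$ if $e'=e$, $-1$ if $e'=\overline{e}$, $0$ otherwise. $\partial^*:C_0(X_0,\mathbb{R})\to C_1(X_0,\mathbb{R})$ is the adjoint of $\partial$; it maps $C_0(X_0,\mathbb{Z})$ into $C_1(X_0,\mathbb{Z})$. $P_0:C_1(X_0,\mathbb{R})\to H_1(X_0,\mathbb{R})$ is the orthogonal projection. $H_1(X_0,\mathbb{Z})^{\#}=\{{\bf x}\in H_1(X_0,\mathbb{R})\mid\langle{\bf x},{\bf y}\rangle\in\mathbb{Z}\ ({\bf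 y}\in H_1(X_0,\mathbb{Z}))\}$ is the dual lattice, and the Jacobian is $\mathcal{J}(X_0)=H_1(X_0,\mathbb{Z})^{\#}/H_1(X_0,\mathbb{Z})$. Let $\epsilon:C_0(X_0,\mathbb{Z})\to\mathbb{Z}$, $\epsilon(\sum a_xx)=\sum a_x$; put ${\rm Div}^0(X_0)=\ker\epsilon$ (which equals $\partial C_1(X_0,\mathbb{Z})$), ${\rm Prin}(X_0)=\partial\partial^*(C_0(X_0,\mathbb{Z}))$, and ${\rm Pic}(X_0)={\rm Div}^0(X_0)/{\rm Prin}(X_0)$. *)

(* Defs.v *)
From HB Require Import structures.
From mathcomp Require Import all_boot all_order all_algebra.
From mathcomp Require Import boolp reals.
Set Implicit Arguments.
Unset Strict Implicit.
Unset Printing Implicit Defensive.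
Import Order.TTheory GRing.Theory Num.Theory.
Local Open Scope ring_scope.

(* Serre-style graph: [edge] is the set of directed edges. Loops and multiple
   edges are allowed; [einv] has no fixed point, so a loop also counts as two
   directed edges. *)
Record graph := Graph {
  vertex : finType;
  edge : finType;
  org : edge -> vertex;
  ter : edge -> vertex;
  einv : edge -> edge;
  einvK : involutive einv;
  einv_neq : forall e, einv e != e;
  org_einv : forall e, org (einv e) = ter e
}.

Arguments org {g} e.
Arguments ter {g} e.
Arguments einv {g} e.

Lemma ter_einv (X : graph) (e : edge X) : ter (einv e) = org e.
Proof. by rewrite -org_einv einvK. Qed.

Definition adjacent (X : graph) : rel (vertex X) :=
  [rel x y | [exists e : edge X, (org e == x) && (ter e == y)]].

Definition connected_graph (X : graph) : Prop :=
  (0 < #|vertex X|)%N /\ forall x y : vertex X, connect (@adjacent X) x y.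

Definition degree (X : graph) (x : vertex X) : nat :=
  #|[set e : edge X | org e == x]|.

Definition chain0 (X : graph) (A : Type) := {ffun vertex X -> A}.

(* C_1(X, A), the A-combinations of directed edges modulo [einv e = - e], as
   the antisymmetric functions on directed edges: [a e] is the coefficient of
   [e], and [- a e] that of its inverse. *)
Definition antisym (X : graph) (A : zmodType) : {pred {ffun edge X -> A}} :=
  fun a => [forall e, a (einv e) == - a e].
Arguments antisym : clear implicits.

Record chain1 (X : graph) (A : zmodType) := Chain1 {
  coef :> {ffun edge X -> A};
  chain1P : coef \in antisym X A
}.

Section ChainStructures.
Variable X : graph.

Fact antisym_zmod_closed (A : zmodType) : zmod_closed (antisym X A).
Proof.
split=> [|a b /forallP ha /forallP hb]; apply/forallP=> e.
  by rewrite !ffunE oppr0.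
by rewrite !ffunE (eqP (ha e)) (eqP (hb e)) opprD.
Qed.
HB.instance Definition _ (A : zmodType) :=
  GRing.isZmodClosed.Build {ffun edge X -> A} (antisym X A)
    (antisym_zmod_closed A).

HB.instance Definition _ (A : zmodType) := [isSub for @coef X A].
HB.instance Definition _ (A : zmodType) := [Choice of chain1 X A by <:].
HB.instance Definition _ (A : zmodType) :=
  [SubChoice_isSubZmodule of chain1 X A by <:].

Lemma chain1N (A : zmodType) (a : chain1 X A) e : a (einv e) = - a e.
Proof. exact/eqP/(forallP (chain1P a)). Qed.

Lemma chain1_eq (A : zmodType) (a b : chain1 X A) : a =1 b -> a = b.
Proof. by move=> ab; apply/val_inj/ffunP. Qed.

Fact antisym_scaler_closed (K : pzRingType) (W : lmodType K) :
  scaler_closed (antisym X W).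
Proof.
move=> k a /forallP ha; apply/forallP=> e.
by rewrite !ffunE (eqP (ha e)) scalerN.
Qed.
HB.instance Definition _ (K : pzRingType) (W : lmodType K) :=
  GRing.isScaleClosed.Build K {ffun edge X -> W} (antisym X W)
    (@antisym_scaler_closed K W).
HB.instance Definition _ (K : pzRingType) (W : lmodType K) :=
  [SubZmodule_isSubLmodule of chain1 X W by <:].

Section Vect.
Variables (K : fieldType) (W : vectType K).

Let sym_part (a : {ffun edge X -> W}) : {ffun edge X -> W} :=
  [ffun e => a (einv e) + a e].

Fact sym_part_linear : linear sym_part.
Proof.
by move=> k a b; apply/ffunP=> e; rewrite !ffunE scalerDr addrACA.
Qed.
HB.instance Definition _ :=
  GRing.isLinear.Build K _ _ _ sym_part sym_part_linear.

Fact chain1_vect_axiom : Vector.axiom (\dim (lker (linfun sym_part)))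
  (chain1 X W).
Proof.
set U := lker _.
have memU a : (a \in U) = (a \in antisym X W).
  rewrite memv_ker lfunE /=; apply/eqP/forallP => [/ffunP h e|h].
    by have := h e; rewrite !ffunE => /eqP; rewrite addr_eq0.
  by apply/ffunP=> e; rewrite !ffunE (eqP (h e)) addNr.
have [f lf bf] := subvs_vect_iso U.
have gU (u : subvs_of U) : vsval u \in antisym X W by rewrite -memU subvsP.
exists (fun a : chain1 X W => f (vsproj U (coef a))).
  by move=> k a b; rewrite linearP lf.
case: bf => g fK gK; exists (fun r => Chain1 (gU (g r))) => [a|r].
  by apply/val_inj; rewrite /= fK vsprojK // memU chain1P.
by rewrite /= vsvalK gK.
Qed.
HB.instance Definition _ :=
  Lmodule_hasFinDim.Build K (chain1 X W) chain1_vect_axiom.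
End Vect.

End ChainStructures.

Definition vertex0 (X : graph) (A : nzRingType) (x : vertex X) : chain0 X A :=
  [ffun y => (y == x)%:R].

Fact edge1_subproof (X : graph) (A : nzRingType) (e : edge X) :
  [ffun e' => (e' == e)%:R - (e' == einv e)%:R] \in antisym X A.
Proof.
apply/forallP=> e'; rewrite !ffunE opprB.
by rewrite !(inv_eq (@einvK X)) einvK.
Qed.
Definition edge1 (X : graph) (A : nzRingType) (e : edge X) : chain1 X A :=
  Chain1 (edge1_subproof A e).
Arguments vertex0 {X} A x.
Arguments edge1 {X} A e.

(* [e] and [einv e] together contribute [a e *: (ter e - org e)]. *)
Definition boundary (X : graph) (A : zmodType) (a : chain1 X A) : chain0 X A :=
  [ffun x => \sum_(e | ter e == x) a e].

Lemma boundary_edge1 (X : graph) (A : nzRingType) (e : edge X) :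
  boundary (edge1 A e) = vertex0 A (ter e) - vertex0 A (org e).
Proof.
apply/ffunP=> x; rewrite !ffunE.
under eq_bigr do rewrite ffunE.
rewrite sumrB; congr (_ - _).
  rewrite big_mkcond (bigD1 e) //= eqxx big1 ?addr0 => [|i /negPf->].
    by rewrite eq_sym; case: eqP.
  by case: ifP.
rewrite big_mkcond (bigD1 (einv e)) //= eqxx big1 ?addr0 => [|i /negPf->].
  by rewrite ter_einv eq_sym; case: eqP.
by case: ifP.
Qed.

Section Boundary.
Variable X : graph.

Fact boundary_zmod_morphism (A : zmodType) : zmod_morphism (@boundary X A).
Proof.
move=> a b; apply/ffunP=> x; rewrite !ffunE -sumrB.
by apply: eq_bigr => e _; rewrite !ffunE.
Qed.
HB.instance Definition _ (A : zmodType) :=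
  GRing.isZmodMorphism.Build (chain1 X A) (chain0 X A) (@boundary X A)
    (@boundary_zmod_morphism A).

Fact boundary_scalable (K : pzRingType) (W : lmodType K) :
  scalable (@boundary X W : chain1 X W -> {ffun vertex X -> W}).
Proof.
move=> k a; apply/ffunP=> x; rewrite !ffunE scaler_sumr.
by apply: eq_bigr => e _; rewrite !ffunE.
Qed.
HB.instance Definition _ (K : pzRingType) (W : lmodType K) :=
  GRing.isScalable.Build K (chain1 X W) {ffun vertex X -> W} *:%R
    (@boundary X W) (@boundary_scalable K W).
End Boundary.

Definition dot0 (X : graph) (A : nzRingType) (f g : chain0 X A) : A :=
  \sum_x f x * g x.

(* The inner product on C_1(X, R); each pair [e], [einv e] is summed twice. *)
Definition dot1 (X : graph) (R : realType) (a b : chain1 X R^o) : R :=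
  2^-1 * \sum_e (a e : R) * (b e : R).

Fact half_double (R : realType) (r : R) : 2^-1 * (r + r) = r.
Proof. by rewrite -mulr2n -[r *+ 2]mulr_natl mulKf ?pnatr_eq0. Qed.

Section InnerProduct.
Variables (X : graph) (R : realType).
Local Notation C1R := (chain1 X R^o).
Local Notation dot1 := (@dot1 X R).

Lemma dot1C (a b : C1R) : dot1 a b = dot1 b a.
Proof. by congr (_ * _); apply: eq_bigr => e _; rewrite mulrC. Qed.

Fact dot1_linear (a : C1R) : scalar (dot1 a).
Proof.
move=> k b c; rewrite /= /Defs.dot1 [k * _]mulrCA -mulrDr; congr (_ * _).
rewrite mulr_sumr -big_split; apply: eq_bigr => e _.
by rewrite !ffunE mulrDr [k *: _]/(k * _) mulrCA.
Qed.

Fact dot1_bilinear : bilinear_for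
  (GRing.Scale.Law.clone _ _ *%R _) (GRing.Scale.Law.clone _ _ (idfun \; *%R) _)
  dot1.
Proof.
split=> [b k a c|a]; last exact: dot1_linear.
by rewrite /= ![dot1 _ b]dot1C dot1_linear.
Qed.
HB.instance Definition _ :=
  bilinear_isBilinear.Build R C1R C1R R *%R (idfun \; *%R) dot1 dot1_bilinear.

Fact dot1_herm (a b : C1R) : dot1 a b = (-1) ^+ false * idfun (dot1 b a).
Proof. by rewrite mul1r dot1C. Qed.
HB.instance Definition _ :=
  isHermitianSesquilinear.Build R C1R false idfun dot1 dot1_herm.

Fact dot1_gt0 (a : C1R) : a != 0 -> 0 < dot1 a a.
Proof.
move=> a0; rewrite mulr_gt0 ?invr_gt0 ?ltr0n // lt_neqAle eq_sym.
rewrite sumr_ge0 ?andbT => [|e _]; last by rewrite -expr2 sqr_ge0.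
apply: contra a0; rewrite psumr_eq0 => [/allP h|e _]; last first.
  by rewrite -expr2 sqr_ge0.
apply/eqP/chain1_eq => e; have := h e (mem_index_enum _).
by rewrite mulf_eq0 orbb ffunE => /eqP.
Qed.
HB.instance Definition _ := isDotProduct.Build R C1R dot1 dot1_gt0.

Lemma dot1_edge1r (a : C1R) e : dot1 a (edge1 R^o e) = a e.
Proof.
rewrite /Defs.dot1; under eq_bigr do rewrite ffunE mulrBr.
rewrite sumrB (bigD1 e) //= eqxx mulr1 big1 ?addr0 => [|i /negPf->]; last first.
  by rewrite mulr0.
rewrite (bigD1 (einv e)) //= eqxx mulr1 big1 ?addr0 => [|i /negPf->]; last first.
  by rewrite mulr0.
by rewrite chain1N opprK; exact: half_double.
Qed.

Lemma dot1_edge1 e e' : dot1 (edge1 R^o e) (edge1 R^o e') =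
  if e' == e then 1 else if e' == einv e then -1 else 0.
Proof.
rewrite dot1_edge1r ffunE; case: eqP => [->|_].
  by rewrite eq_sym (negPf (einv_neq e)) subr0.
by case: eqP => _; rewrite sub0r ?oppr0.
Qed.
End InnerProduct.

(* The adjoint of [boundary]: the coefficient of [e] in [coboundary f], which
   is <coboundary f, e>, is <f, boundary e>. *)
Fact coboundary_subproof (X : graph) (A : nzRingType) (f : chain0 X A) :
  [ffun e => dot0 f (boundary (edge1 A e))] \in antisym X A.
Proof.
apply/forallP=> e; rewrite !ffunE !boundary_edge1 ter_einv org_einv -sumrN.
by apply/eqP/eq_bigr => x _; rewrite -mulrN !ffunE opprB.
Qed.
Definition coboundary (X : graph) (A : nzRingType) (f : chain0 X A) :
  chain1 X A := Chain1 (coboundary_subproof f).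

Lemma coboundaryE (X : graph) (A : nzRingType) (f : chain0 X A) (e : edge X) :
  coboundary f e = f (ter e) - f (org e).
Proof.
rewrite ffunE boundary_edge1 /dot0.
under eq_bigr do rewrite !ffunE mulrBr.
rewrite sumrB; congr (_ - _).
  by rewrite (bigD1 (ter e)) //= eqxx mulr1 big1 ?addr0 // => i /negPf->;
    rewrite mulr0.
by rewrite (bigD1 (org e)) //= eqxx mulr1 big1 ?addr0 // => i /negPf->;
  rewrite mulr0.
Qed.

Lemma coboundary_adjoint (X : graph) (R : realType) (f : chain0 X R^o)
  (a : chain1 X R^o) : dot1 (coboundary f) a = dot0 f (boundary a).
Proof.
have sumE (F : vertex X -> R) (pt : edge X -> vertex X) :
    \sum_e F (pt e) * (a e : R) = \sum_x F x * \sum_(e | pt e == x) (a e : R).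
  rewrite (partition_big pt xpredT) //=; apply: eq_bigr => x _.
  by rewrite mulr_sumr; apply: eq_bigr => e /eqP->.
have orgE : \sum_e f (org e) * (a e : R) = - \sum_e f (ter e) * (a e : R).
  rewrite (reindex_inj (inv_inj (@einvK X))) -sumrN.
  by apply: eq_bigr => e _; rewrite org_einv chain1N mulrN.
rewrite /dot1; under eq_bigr do rewrite coboundaryE mulrBl.
rewrite sumrB orgE opprK half_double.
by rewrite sumE; apply: eq_bigr => x _; rewrite ffunE.
Qed.

Section Jacobian.
Variables (X : graph) (R : realType).
Local Notation C1R := (chain1 X R^o).

Fact real_chain_subproof (a : chain1 X int) :
  [ffun e => (a e)%:~R : R^o] \in antisym X R^o.
Proof. by apply/forallP=> e; rewrite !ffunE chain1N rmorphN. Qed.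
Definition real_chain (a : chain1 X int) : C1R :=
  Chain1 (real_chain_subproof a).

Definition H1Z : {pred chain1 X int} := fun b => boundary b == 0.

Definition H1R : {vspace C1R} := lker (linfun (@boundary X R^o)).

Lemma mem_H1R (a : C1R) : (a \in H1R) = (boundary a == 0).
Proof. by rewrite memv_ker lfunE. Qed.

Lemma real_chain_H1 (b : chain1 X int) : (real_chain b \in H1R) = (b \in H1Z).
Proof.
have bdE x : boundary (real_chain b) x = (boundary b x)%:~R.
  by rewrite !ffunE rmorph_sum; apply: eq_bigr => e _; rewrite ffunE.
rewrite mem_H1R; apply/eqP/eqP => /ffunP h; apply/ffunP => x; have := h x.
  by rewrite bdE !ffunE => /eqP; rewrite intr_eq0 => /eqP.
by rewrite bdE => ->; rewrite !ffunE.
Qed.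

Definition orthc (U : {vspace C1R}) : {vspace C1R} :=
  orthov (@dot1 X R : {hermitian C1R for false & idfun}) U.

Lemma orthcP (U : {vspace C1R}) (a : C1R) :
  reflect {in U, forall b, dot1 a b = 0} (a \in orthc U).
Proof. exact: mem_orthovP. Qed.

(* The orthogonal projection onto H_1(X, R): [daddv_pi U V] is the projection
   onto [U] along [V]. *)
Definition P0 : 'End(C1R) := daddv_pi H1R (orthc H1R).

Lemma cap_orthc (U : {vspace C1R}) : (U :&: orthc U = 0)%VS.
Proof.
apply/eqP; rewrite -subv0; apply/subvP => a; rewrite memv_cap memv0.
case/andP=> aU /orthcP/(_ a aU) a0; apply/negPn/negP => /dot1_gt0.
by rewrite a0 ltxx.
Qed.

Lemma add_orthc (U : {vspace C1R}) :
  (U + orthc U = fullv)%VS.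
Proof.
pose f (a : C1R) : 'rV[R]_(\dim U) := \row_i dot1 a (vbasis U)`_i.
have lf : linear f.
  move=> k a b; apply/rowP=> i; rewrite !mxE dot1C dot1_linear.
  by rewrite ![dot1 (vbasis U)`_i _]dot1C.
pose F := linfun (HB.pack_for {linear C1R -> 'rV[R]_(\dim U)} f
  (GRing.isLinear.Build R C1R 'rV[R]_(\dim U) *:%R f lf)).
have kF : (lker F <= orthc U)%VS.
  apply/subvP=> a; rewrite memv_ker lfunE => /eqP/rowP fa0.
  apply/orthcP => b /coord_vbasis ->; rewrite linear_sumr big1 // => i _.
  by rewrite linearZr_LR /=; have := fa0 i; rewrite !mxE => ->; rewrite mulr0.
apply/eqP; rewrite eqEdim subvf /= dimv_disjoint_sum ?cap_orthc //.
rewrite -(limg_ker_dim F fullv) capfv addnC leq_add ?dimvS //.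
by rewrite (leq_trans (dimvS (subvf _))) // dimvf /dim /= mul1n.
Qed.

Lemma P0_H1 (a : C1R) : P0 a \in H1R.
Proof. exact: memv_pi. Qed.

Lemma P0_orth (a b : C1R) : b \in H1R -> dot1 (P0 a) b = dot1 a b.
Proof.
move=> bH; have aV : a \in (H1R + orthc H1R)%VS by rewrite add_orthc memvf.
have /esym aE := daddv_pi_add (cap_orthc H1R) aV.
rewrite [in RHS]aE [RHS]dot1C linearDr /= ![dot1 b _]dot1C.
have /orthcP -> // := memv_pi (orthc H1R) H1R a.
by rewrite addr0.
Qed.

Lemma dot1_real_chain (a b : chain1 X int) :
  dot1 (real_chain a) (real_chain b) \is a Num.int.
Proof.
pose pos e := (enum_rank e < enum_rank (einv e :> edge X))%N.
pose F (e : edge X) : R := (a e * b e)%:~R.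
have posN e : pos (einv e) = ~~ pos e.
  rewrite /pos einvK -leqNgt [RHS]leq_eqVlt.
  case: eqP => // /ord_inj/enum_rank_inj/eqP.
  by rewrite (negPf (einv_neq e)).
suff -> : dot1 (real_chain a) (real_chain b) = \sum_(e | pos e) F e.
  by rewrite rpred_sum // => e _; apply: intr_int.
rewrite -[RHS]half_double; congr (_ * _); rewrite (bigID pos) /=; congr (_ + _).
  by apply: eq_bigr => e _; rewrite !ffunE -intrM.
rewrite (reindex_inj (inv_inj (@einvK X))) /=.
apply: eq_big => [e|e _]; first by rewrite posN negbK.
by rewrite !ffunE -intrM !chain1N mulrNN.
Qed.

Definition in_dual : {pred C1R} := fun a =>
  (a \in H1R) &&
  `[< forall b, b \in H1Z -> dot1 a (real_chain b) \is a Num.int >].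

Fact in_dual_zmod_closed : zmod_closed in_dual.
Proof.
split=> [|a b /andP[aH /asboolP ai] /andP[bH /asboolP bi]].
  apply/andP; split; first exact: mem0v.
  by apply/asboolP=> c _; rewrite dot1C linear0r.
apply/andP; split; first exact: memvB.
apply/asboolP=> c cH.
rewrite dot1C linearBr /= ![dot1 (real_chain c) _]dot1C.
by rewrite rpredB ?ai ?bi.
Qed.
HB.instance Definition _ :=
  GRing.isZmodClosed.Build C1R in_dual in_dual_zmod_closed.

(* H_1(X, Z)^# as a type, so that its quotient is a Z-module. *)
Record dual_H1 := DualH1 { dual_val : C1R; dualP : dual_val \in in_dual }.
HB.instance Definition _ := [isSub for dual_val].
HB.instance Definition _ := [Choice of dual_H1 by <:].
HB.instance Definition _ := [SubChoice_isSubZmodule of dual_H1 by <:].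

Definition lattice_H1 : {pred dual_H1} := fun a =>
  `[< exists2 b, b \in H1Z & dual_val a = real_chain b >].

Fact real_chain_zmod_morphism : zmod_morphism real_chain.
Proof.
by move=> a b; apply/chain1_eq => e; rewrite !ffunE rmorphB.
Qed.
HB.instance Definition _ :=
  GRing.isZmodMorphism.Build _ _ real_chain real_chain_zmod_morphism.

Fact lattice_zmod_closed : zmod_closed lattice_H1.
Proof.
split=> [|a b /asboolP[a' aH aE] /asboolP[b' bH bE]]; apply/asboolP.
  by exists 0; [rewrite unfold_in raddf0 | rewrite raddf0].
exists (a' - b'); last by rewrite raddfB /= -aE -bE.
by rewrite unfold_in raddfB /= (eqP aH) (eqP bH) subrr.
Qed.
HB.instance Definition _ :=
  GRing.isZmodClosed.Build dual_H1 lattice_H1 lattice_zmod_closed.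

Definition Jac := Quotient.quot lattice_H1.

Fact P0_dual_subproof (a : chain1 X int) : P0 (real_chain a) \in in_dual.
Proof.
apply/andP; split; first exact: P0_H1.
apply/asboolP=> b bH; rewrite P0_orth ?real_chain_H1 //.
exact: dot1_real_chain.
Qed.
Definition P0_dual (a : chain1 X int) : dual_H1 := DualH1 (P0_dual_subproof a).

End Jacobian.

Section Picard.
Variable X : graph.

Definition augmentation (f : chain0 X int) : int := \sum_x f x.

Fact augmentation_zmod_morphism : zmod_morphism augmentation.
Proof. by move=> f g; rewrite -sumrB; apply: eq_bigr => x _; rewrite !ffunE. Qed.
HB.instance Definition _ := GRing.isZmodMorphism.Build (chain0 X int) int
  augmentation augmentation_zmod_morphism.

Definition ker_augmentation : {pred chain0 X int} :=
  fun f => augmentation f == 0.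

Fact ker_augmentation_zmod_closed : zmod_closed ker_augmentation.
Proof.
split=> [|f g /eqP fE /eqP gE]; rewrite unfold_in ?raddf0 //.
by rewrite raddfB /= fE gE subrr.
Qed.
HB.instance Definition _ := GRing.isZmodClosed.Build (chain0 X int)
  ker_augmentation ker_augmentation_zmod_closed.

Record Div0 := MkDiv0 {
  div_val : chain0 X int;
  divP : div_val \in ker_augmentation
}.
HB.instance Definition _ := [isSub for div_val].
HB.instance Definition _ := [Choice of Div0 by <:].
HB.instance Definition _ := [SubChoice_isSubZmodule of Div0 by <:].

Definition Prin : {pred Div0} := fun d =>
  `[< exists f : chain0 X int, div_val d = boundary (coboundary f) >].

Fact coboundary_zmod_morphism (A : nzRingType) :
  zmod_morphism (@coboundary X A).
Proof.
move=> f g; apply/chain1_eq => e.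
transitivity (coboundary f e - coboundary g e); last by rewrite !ffunE.
by rewrite !coboundaryE !ffunE !opprD addrACA.
Qed.
HB.instance Definition _ (A : nzRingType) := GRing.isZmodMorphism.Build
  (chain0 X A) (chain1 X A) (@coboundary X A) (@coboundary_zmod_morphism A).

Fact Prin_zmod_closed : zmod_closed Prin.
Proof.
split=> [|c d /asboolP[f fE] /asboolP[g gE]]; apply/asboolP.
  by exists 0; rewrite !raddf0.
by exists (f - g); rewrite !raddfB /= -fE -gE.
Qed.
HB.instance Definition _ :=
  GRing.isZmodClosed.Build Div0 Prin Prin_zmod_closed.

Definition Pic := Quotient.quot Prin.

Fact boundary_div_subproof (a : chain1 X int) :
  boundary a \in ker_augmentation.
Proof.
have -> : (boundary a \in ker_augmentation) = (\sum_e a e == 0).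
  rewrite unfold_in /augmentation (partition_big ter xpredT) //=.
  by congr (_ == 0); apply: eq_bigr => x _; rewrite ffunE.
rewrite -[_ == 0]/((2 == 0%N) || (_ == 0)) -mulrn_eq0 mulr2n.
rewrite {1}(reindex_inj (inv_inj (@einvK X))).
by rewrite -big_split big1 // => e _; rewrite chain1N /= addNr.
Qed.
Definition boundary_div (a : chain1 X int) : Div0 :=
  MkDiv0 (boundary_div_subproof a).

End Picard.

Arguments in_dual X R : clear implicits.
Arguments lattice_H1 X R : clear implicits.
Arguments Jac X R : clear implicits.

(* Main.v *)
From HB Require Import structures.
Require Import Defs.
From mathcomp Require Import all_boot all_order all_algebra.
From mathcomp Require Import boolp reals.
Set Implicit Arguments.
Unset Strict Implicit.
Unset Printing Implicit Defensive.
Import GRing.Theory Num.Theory.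
Local Open Scope ring_scope.
Local Open Scope quotient_scope.

(** Both groups are quotients of [C_1(X, Z)]: the first by [alpha |-> boundary
    alpha] modulo [Prin], the second by [alpha |-> P0 alpha] modulo
    [H_1(X, Z)].  So it suffices that both maps are onto and have the same
    kernel, which is [H_1(X, Z) + coboundary C_0(X, Z)]
    ([additive_bijection_of_same_kernel], [Prin_boundary_div] and
    [lattice_P0_dual]).

    Everything else rests on a choice, possible by connectedness, of an integral
    chain [p v] running from a base vertex [r] to each vertex [v].  A divisor
    [d] of degree zero is the boundary of the sum of the [p v] with
    coefficients [d v], so the first map is onto.  For the second map, close
    each edge [e] into an integral cycle by means of [p (org e)] and
    [p (ter e)]; pairing a real chain [y] with that cycle gives the coefficient
    at [e] of [y - coboundary f], where [f v] is the pairing of [y] with [p v]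
    ([dot1_fundamental_cycle]).  This has two consequences, because coboundaries
    are orthogonal to cycles:
    - if [y] pairs integrally with all integral cycles, then
      [y - coboundary f] is an integral chain with the same projection as [y],
      so every element of the dual lattice is the projection of an integral
      chain;
    - if [y] is integral and orthogonal to all cycles, then [y = coboundary f]
      and [f] is integral, which describes the kernel of [P0] on integral
      chains. *)

(** * Additive maps with the same kernel *)

(** The first isomorphism theorem in symmetric form: both targets are the
    source modulo the common kernel.  A set-theoretic section of [f] followed by
    [g] is additive because two preimages differ by an element of the kernel. *)
Lemma additive_bijection_of_same_kernel (U V W : zmodType)
    (f : {additive U -> V}) (g : {additive U -> W}) :
    (forall v, exists u, f u = v) -> (forall w, exists u, g u = w) ->
    (forall u, f u = 0 <-> g u = 0) ->
  exists phi : {additive V -> W}, bijective phi /\ forall u, phi (f u) = g u.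
Proof.
move=> /choice[s sK] /choice[t tK] kerE.
have gsf u : g (s (f u)) = g u.
  by apply/eqP; rewrite -subr_eq0 -raddfB; apply/eqP/kerE;
    rewrite raddfB sK subrr.
have ftg u : f (t (g u)) = f u.
  by apply/eqP; rewrite -subr_eq0 -raddfB; apply/eqP/kerE;
    rewrite raddfB tK subrr.
have phiB : zmod_morphism (g \o s).
  by move=> v w; rewrite /= -{1}[v]sK -{1}[w]sK -raddfB gsf raddfB.
pose phi : {additive V -> W} := HB.pack_for {additive V -> W} (g \o s)
  (GRing.isZmodMorphism.Build V W (g \o s) phiB).
exists phi; split=> [|u]; last exact: gsf.
by exists (f \o t) => [v|w] /=; [rewrite ftg sK | rewrite gsf tK].
Qed.

(** * Paths as integral chains *)

Lemma boundary_of_connect (X : graph) (x y : vertex X) :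
  connect (@adjacent X) x y ->
  exists p : chain1 X int, boundary p = vertex0 int y - vertex0 int x.
Proof.
case/connectP=> s; elim: s x => [|z s IHs] x /=.
  by move=> _ ->; exists 0; rewrite raddf0 subrr.
case/andP=> /existsP[e /andP[/eqP ox /eqP tz]] zs yE.
have [p pE] := IHs _ zs yE.
exists (p + edge1 int e).
by rewrite raddfD /= pE boundary_edge1 ox tz addrA subrK.
Qed.

Definition rooted_paths (X : graph) (r : vertex X)
    (p : vertex X -> chain1 X int) : Prop :=
  forall v, boundary (p v) = vertex0 int v - vertex0 int r.

Lemma rooted_paths_exist (X : graph) :
  connected_graph X -> exists r p, @rooted_paths X r p.
Proof.
case=> /card_gt0P[r _] conn; exists r.
by have /choice[p pE] := fun v => boundary_of_connect (conn r v); exists p.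
Qed.

Lemma boundary_div_surj (X : graph) (r : vertex X) p (d : Div0 X) :
  rooted_paths r p -> exists alpha, boundary_div alpha = d.
Proof.
move=> pE; exists (\sum_v p v *~ div_val d v); apply: val_inj => /=.
(* The paths contribute [d] minus (deg d)-many copies of the base vertex. *)
have degd0 : \sum_v div_val d v = 0 by exact/eqP/(divP d).
rewrite raddf_sum /=; apply/ffunP=> x; rewrite sum_ffunE.
under eq_bigr => v _ do
  rewrite raddfMz /= pE ffunMzE !ffunE mulrzz mulrC mulrBr.
rewrite sumrB -mulr_suml degd0 mul0r subr0 (bigD1 x) //= eqxx mulr1.
by rewrite big1 ?addr0 // => v /negPf; rewrite eq_sym => ->; rewrite mulr0.
Qed.

(** * Fundamental cycles and potentials *)

Definition fundamental_cycle (X : graph) (p : vertex X -> chain1 X int)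
  (e : edge X) : chain1 X int := p (org e) + edge1 int e - p (ter e).

Lemma fundamental_cycle_H1Z (X : graph) (r : vertex X) p e :
  rooted_paths r p -> fundamental_cycle p e \in @H1Z X.
Proof.
move=> pE; apply/eqP; rewrite raddfB raddfD /= !pE boundary_edge1.
by rewrite [_ - _ + _]addrC addrA subrK subrr.
Qed.

Lemma real_chain_edge1 (X : graph) (R : realType) (e : edge X) :
  real_chain R (edge1 int e) = edge1 R^o e.
Proof. by apply/chain1_eq => e'; rewrite !ffunE rmorphB !natz. Qed.

Definition potential (X : graph) (R : realType) (p : vertex X -> chain1 X int)
  (y : chain1 X R^o) : chain0 X R^o := [ffun v => dot1 y (real_chain R (p v))].

(** The two path terms of the fundamental cycle at [e] pair with [y] to the
    difference of the potential along [e]. *)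
Lemma dot1_fundamental_cycle (X : graph) (R : realType) p
    (y : chain1 X R^o) (e : edge X) :
  dot1 y (real_chain R (fundamental_cycle p e)) =
  (y - coboundary (potential p y)) e.
Proof.
rewrite raddfB raddfD /= real_chain_edge1 linearBr linearDr /= dot1_edge1r.
rewrite [RHS]ffunE [Y in _ = _ + Y]ffunE coboundaryE !ffunE.
by rewrite opprB addrCA addrA.
Qed.

(** * The orthogonal projection *)

Lemma P0_unique (X : graph) (R : realType) (a x : chain1 X R^o) :
  x \in H1R X R -> {in H1R X R, forall b, dot1 x b = dot1 a b} ->
  P0 X R a = x.
Proof.
move=> xH xa; apply/eqP; rewrite -subr_eq0; apply/negPn/negP => /dot1_gt0.
have dH : P0 X R a - x \in H1R X R by rewrite memvB ?P0_H1.
by rewrite linearBl /= P0_orth // xa // subrr Order.POrderTheory.ltxx.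
Qed.

Lemma P0_id (X : graph) (R : realType) (x : chain1 X R^o) :
  x \in H1R X R -> P0 X R x = x.
Proof. by move=> xH; apply: P0_unique. Qed.

Lemma P0_coboundary (X : graph) (R : realType) (f : chain0 X R^o) :
  P0 X R (coboundary f) = 0.
Proof.
apply: P0_unique => [|b]; first exact: mem0v.
rewrite mem_H1R coboundary_adjoint => /eqP->.
by rewrite linear0l /dot0 big1 // => x _; rewrite ffunE mulr0.
Qed.

Lemma real_chain_coboundary (X : graph) (R : realType) (f : chain0 X int) :
  real_chain R (coboundary f) =
  coboundary ([ffun x => (f x)%:~R] : chain0 X R^o).
Proof.
apply/chain1_eq => e; rewrite coboundaryE ffunE.
by rewrite coboundaryE !ffunE rmorphB.
Qed.

Lemma real_chain_of_int_coef (X : graph) (R : realType) (y : chain1 X R^o) :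
  (forall e, (y e : R) \is a Num.int) -> exists a, y = real_chain R a.
Proof.
move=> /(_ _)/intrP yZ.
have /choice[n yE] : forall e, exists m : int, (y e : R) = m%:~R.
  by move=> e; apply: yZ.
have nN : [ffun e => n e] \in antisym X int.
  apply/forallP=> e; rewrite !ffunE -(@eqr_int R) rmorphN /= -!yE.
  by rewrite chain1N.
by exists (Chain1 nN); apply/chain1_eq => e; rewrite !ffunE yE.
Qed.

(** * Surjectivity and kernel of the projection on integral chains *)

(** The correction of [y] by the coboundary of its potential is integral when
    [y] is in the dual lattice, and [P0] kills coboundaries. *)
Lemma P0_dual_surj (X : graph) (R : realType) (r : vertex X) p
    (y : dual_H1 X R) :
  rooted_paths r p -> exists alpha, P0_dual R alpha = y.
Proof.
move=> pE; case/andP: (dualP y) => yH /asboolP yZ.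
pose z := dual_val y - coboundary (potential p (dual_val y)).
have [|alpha zE] := @real_chain_of_int_coef X R z.
  move=> e; rewrite -dot1_fundamental_cycle yZ //.
  exact: (fundamental_cycle_H1Z _ pE).
exists alpha; apply: val_inj => /=.
by rewrite -zE linearB /= P0_coboundary subr0 P0_id.
Qed.

(** An integral chain orthogonal to all cycles is the coboundary of its own
    potential, which is integral because the paths are. *)
Lemma coboundary_of_P0_eq0 (X : graph) (R : realType) (r : vertex X) p
    (a : chain1 X int) :
  rooted_paths r p -> P0 X R (real_chain R a) = 0 ->
  exists f : chain0 X int, a = coboundary f.
Proof.
move=> pE a0.
have /choice[f fE] :
    forall v, exists m : int,
      dot1 (real_chain R a) (real_chain R (p v)) = m%:~R.
  by move=> v; apply/intrP/dot1_real_chain.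
exists [ffun v => f v]; apply/chain1_eq => e.
have cH := fundamental_cycle_H1Z e pE.
have := dot1_fundamental_cycle p (real_chain R a) e.
rewrite -P0_orth ?real_chain_H1 // a0 linear0l => /esym/eqP.
rewrite [Y in Y == _]ffunE [Y in _ + Y]ffunE subr_eq0.
by rewrite !coboundaryE !ffunE !fE -rmorphB eqr_int => /eqP.
Qed.

(** * The two quotient maps on integral chains *)

Lemma boundary_div_zmod_morphism (X : graph) : zmod_morphism (@boundary_div X).
Proof. by move=> a b; apply: val_inj; rewrite /= raddfB. Qed.

HB.instance Definition _ (X : graph) :=
  GRing.isZmodMorphism.Build (chain1 X int) (Div0 X) (@boundary_div X)
    (@boundary_div_zmod_morphism X).

Lemma P0_dual_zmod_morphism (X : graph) (R : realType) :
  zmod_morphism (@P0_dual X R).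
Proof. by move=> a b; apply: val_inj; rewrite /= !raddfB. Qed.

HB.instance Definition _ (X : graph) (R : realType) :=
  GRing.isZmodMorphism.Build (chain1 X int) (dual_H1 X R) (@P0_dual X R)
    (@P0_dual_zmod_morphism X R).

(** The condition on the right is the description of the kernel shared with
    [lattice_P0_dual] below. *)
Lemma Prin_boundary_div (X : graph) (a : chain1 X int) :
  boundary_div a \in @Prin X <->
  exists f : chain0 X int, a - coboundary f \in @H1Z X.
Proof.
split=> [/asboolP[f fE]|[f /eqP fE]]; last apply/asboolP; exists f.
  by apply/eqP; rewrite raddfB; apply/eqP; rewrite subr_eq0; apply/eqP.
by apply/eqP; rewrite -subr_eq0 -raddfB; apply/eqP.
Qed.

Lemma lattice_P0_dual (X : graph) (R : realType) (r : vertex X) p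
    (a : chain1 X int) :
  rooted_paths r p ->
  P0_dual R a \in lattice_H1 X R <->
  exists f : chain0 X int, a - coboundary f \in @H1Z X.
Proof.
move=> pE; split=> [/asboolP[b bH /= aE]|[f fH]].
  have [|f fE] := @coboundary_of_P0_eq0 X R r p (a - b) pE.
    by rewrite raddfB linearB /= aE P0_id ?subrr ?real_chain_H1.
  by exists f; rewrite -fE opprB addrC subrK.
apply/asboolP; exists (a - coboundary f) => //=.
rewrite -[RHS]P0_id ?real_chain_H1 // raddfB linearB /=.
by rewrite real_chain_coboundary P0_coboundary subr0.
Qed.

Lemma pi_quot_eq0 (V : zmodType) (I : zmodClosed V) (v : V) :
  (\pi_(Quotient.quot I) v == 0) = (v \in I).
Proof. by rewrite -(raddf0 \pi_(Quotient.quot I)) -Quotient.idealrBE subr0. Qed.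

Theorem proposition6p1 (R : realType) (X : graph)
  (X_connected : connected_graph X)
  (X_degree : forall x : vertex X, (3 <= degree x)%N) :
  exists phi : {additive Pic X -> Jac X R},
    bijective phi /\
    forall alpha : chain1 X int,
      phi (\pi_(Pic X) (boundary_div alpha)) =
      \pi_(Jac X R) (P0_dual R alpha).
Proof.
have [r [p pE]] := rooted_paths_exist X_connected.
apply: (@additive_bijection_of_same_kernel _ _ _
  (\pi_(Pic X) \o @boundary_div X) (\pi_(Jac X R) \o @P0_dual X R)).
- move=> v; have [alpha aE] := boundary_div_surj (repr v) pE.
  by exists alpha; rewrite /= aE reprK.
- move=> w; have [alpha aE] := P0_dual_surj (repr w) pE.
  by exists alpha; rewrite /= aE reprK.
move=> alpha /=.
have kerE := iff_trans (Prin_boundary_div alpha)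
  (iff_sym (lattice_P0_dual R alpha pE)).
by split=> /eqP; rewrite pi_quot_eq0 => /kerE; rewrite -pi_quot_eq0 => /eqP.
Qed.
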